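(* Let $X$ be a real normed space, let $\Omega\subset X$ be a nonempty closed set and let $F\subset X$ be a nonempty closed bounded convex set with $F\ne\{0\}$. For any $\bar x\in\Omega$, $$\widehat\partial^\infty T_\Omega^F(\bar x)=\widehat N(\bar x;\Omega)\cap F_+^*.$$
   Context: $X^*$ is the dual of $X$ with pairing $\langle x^*,x\rangle=x^*(x)$. The minimal time function is $$T_\Omega^F(x)=\inf\{t\ge0:(x+tF)\cap\Omega\ne\emptyset\},\quad x\in X,$$ with $\inf\emptyset=\infty$. Also $F_+^*=\{x^*\in X^*:\langle x^*,q\rangle\ge0\text{ for all }q\in F\}$. For a subset $\Omega$ of a normed space and $x\in\Omega$, the Fréchet normal cone is $$\widehat N(x;\Omega)=\Big\{x^*:\limsup_{u\to x,\,u\in\Omega}\frac{\langle x^*,u-x\rangle}{\|u-x\|}\le0\Big\}.$$ For $f\colon X\to(-\infty,\infty]$ and $\bar x$ with $f(\bar x)<\infty$, the Fréchet singular subdifferential is $$\widehat\partial^\infty f(\bar x)=\{x^*\in X^*:(x^*,0)\in\widehat N((\bar x,f(\bar x));\mathrm{epi}(f))\},$$ where $\mathrm{epi}(f)=\{(x,\lambda)\in X\times\mathbb R:\lambda\ge f(x)\}$ and $X\times\mathbb R$ carries the norm $\|(x,\lambda)\|=\|x\|+|\lambda|$ (or any equivalent product norm). *)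

(* Defs.v *)
From HB Require Import structures.
From mathcomp Require Import all_boot all_order all_algebra.
From mathcomp Require Import all_classical all_reals all_analysis.
Import Order.TTheory GRing.Theory Num.Theory.
Import numFieldNormedType.Exports.

Set Implicit Arguments.
Unset Strict Implicit.
Unset Printing Implicit Defensive.

Local Open Scope classical_set_scope.
Local Open Scope ring_scope.

(* The topological dual: continuous linear functionals. *)
Record dual (R : realType) (X : normedModType R) := Dual {
  pairing :> {linear X -> R^o};
  dual_continuous : continuous pairing
}.

Section dual_prod.
Context (R : realType) (X : normedModType R) (xs : dual X) (a : R).

Definition dual_prod_fun (z : X * R^o) : R^o := xs z.1 + a * z.2.

Fact dual_prod_linear : linear dual_prod_fun.
Proof.
move=> k u v; rewrite /dual_prod_fun /= linearP mulrDr scalerDr addrACA.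
by congr (_ + _ + (_ + _)); rewrite /GRing.scale /= mulrCA.
Qed.

HB.instance Definition _ :=
  GRing.isLinear.Build R (X * R^o)%type R^o *:%R dual_prod_fun dual_prod_linear.

Fact dual_prod_continuous : continuous dual_prod_fun.
Proof.
move=> z; apply: (@cvgD _ R^o).
  apply: (@continuous_comp _ _ _ (@fst X R^o) xs); first exact: cvg_fst.
  exact: dual_continuous.
by apply: cvgM; [exact: cvg_cst | exact: cvg_snd].
Qed.

(* The pair (xs, a), acting on the product X * R. *)
Definition dual_prod : dual (X * R^o)%type := Dual dual_prod_continuous.

End dual_prod.

Section variational.
Context (R : realType) (X : normedModType R).

Definition minimal_time (F Omega : set X) (x : X) : \bar R :=
  ereal_inf [set t%:E | t in
    [set t : R | 0 <= t /\ [set x + t *: q | q in F] `&` Omega !=set0]].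

Definition positive_dual (F : set X) : set (dual X) :=
  [set xs | forall q, F q -> 0 <= xs q].

(* The difference quotient is taken over u <> x; when x is isolated in Omega
   the upper limit is -oo, so every functional is normal. *)
Definition frechet_normal_cone (x : X) (Omega : set X) : set (dual X) :=
  [set xs | (limf_esup (fun u => (xs (u - x) / `|u - x|)%:E)
                       (within Omega x^') <= 0)%E].

Definition epi (f : X -> \bar R) : set (X * R^o) :=
  [set z | (f z.1 <= z.2%:E)%E].

End variational.

(* Meaningful when f x is finite.  The norm of X * R^o is the max norm, which
   is equivalent to the sum norm and yields the same normal cone. *)
Definition frechet_singular_subdifferential (R : realType)
    (X : normedModType R) (f : X -> \bar R) (x : X) : set (dual X) :=
  [set xs | frechet_normal_cone ((x, fine (f x)) : (X * R^o)%type) (epi f)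
              (dual_prod xs 0)].

(* Main.v *)
Require Import Defs.
From mathcomp Require Import all_boot all_order all_algebra.
From mathcomp Require Import all_classical all_reals all_analysis.
From mathcomp Require Import lra.
Import Order.TTheory GRing.Theory Num.Theory.
Import numFieldNormedType.Exports.
Local Open Scope classical_set_scope.
Local Open Scope ring_scope.

(** Both sides are read off the epsilon-delta form of the Frechet normal cone
    ([frechet_normal_coneP]): [xs] is normal to [A] at [x] when
    [xs (u - x) <= e * `|u - x|] for every [u] in [A] close enough to [x].
    Write [T] for the minimal time function; it vanishes on [Omega], so a
    singular subgradient at [xbar] is an [xs] with
    [xs (u - xbar) <= e * `|(u - xbar, l)|] for [(u, l)] in the epigraph close
    to [(xbar, 0)].

    Two families of epigraph points give the direct inclusion.  Points [(u, 0)]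
    with [u] in [Omega] yield normality to [Omega].  For [q] in [F], going back
    from [xbar] against [q] during a time [t] costs at most [t] to undo, so
    [(xbar - t *: q, t)] lies in the epigraph; letting [t] tend to [0] yields
    [- xs q <= e * `|(q, 1)|] for all [e], that is [0 <= xs q].

    Conversely, let [T u <= l] and let [s > 0] be the norm of [(u - xbar, l)].
    Some [t < l + s] and [q] in [F] send [u] to a point [w = u + t *: q] of
    [Omega].  Since [xs q >= 0], [xs (u - xbar) <= xs (w - xbar)], and since [F]
    is bounded, by [M] say, [`|w - xbar| <= s * (1 + 2 * M)]: normality to
    [Omega] at [xbar] bounds [xs (u - xbar)] by an arbitrarily small multiple
    of [s]. *)

(** * Upper limits and Frechet normals *)

Lemma limf_esup_le0P (R : realType) (X : topologicalType) (f : X -> R)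
    (G : set (set X)) {FG : Filter G} :
  (limf_esup (fun u => (f u)%:E) G <= 0)%E <->
  forall e, 0 < e -> G [set u | f u <= e].
Proof.
split=> [fG e e0|fG].
  have /ereal_inf_lt[_ [A GA <-] Ae] :
      (limf_esup (fun u => (f u)%:E) G < e%:E)%E.
    by apply: le_lt_trans fG _; rewrite lte_fin.
  apply: filterS GA => u Au /=; rewrite -lee_fin; apply: le_trans (ltW Ae).
  by apply: ereal_sup_ubound; exists u.
apply/lee_addgt0Pr => e e0; rewrite add0e.
apply: ge_ereal_inf; exists (ereal_sup [set (f u)%:E | u in [set u | f u <= e]]).
  by exists [set u | f u <= e] => //; exact: fG.
by apply: ge_ereal_sup => _ [u /= fue <-]; rewrite lee_fin.
Qed.

(** Multiplying the quotient out by the norm makes the inequality hold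
    trivially at [u = x], so the base point needs no exclusion. *)
Lemma frechet_normal_coneP (R : realType) (X : normedModType R) (x : X)
    (A : set X) (xs : dual X) :
  frechet_normal_cone x A xs <->
  forall e, 0 < e -> exists2 d, 0 < d &
    forall u, A u -> `|u - x| < d -> xs (u - x) <= e * `|u - x|.
Proof.
rewrite /frechet_normal_cone /= limf_esup_le0P; split=> H e /H.
  rewrite /within /dnbhs /within /= => /nbhs_normP[d /= d0 Hd].
  exists d => // u Au ud.
  have [->|ux] := eqVneq u x; first by rewrite subrr linear0 normr0 mulr0.
  rewrite -ler_pdivrMr ?normr_gt0 ?subr_eq0//.
  by apply: Hd => //; rewrite /= distrC.
move=> [d d0 Hd]; rewrite /within /dnbhs /within /=.
apply/nbhs_normP; exists d => //= u; rewrite /= distrC => ud ux Au.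
by rewrite ler_pdivrMr ?normr_gt0 ?subr_eq0//; exact: Hd.
Qed.

(** * The minimal time function *)

Section minimal_time.
Context {R : realType} {X : normedModType R} (F Omega : set X).
Implicit Types (x q : X) (t l : R) (xs : dual X).

Lemma minimal_time_le x q t : 0 <= t -> F q -> Omega (x + t *: q) ->
  (minimal_time F Omega x <= t%:E)%E.
Proof.
move=> t0 Fq Oxq; apply: ereal_inf_lbound; exists t => //; split=> //.
by exists (x + t *: q); split => //; exists q.
Qed.

Lemma minimal_time_ge0 x : (0 <= minimal_time F Omega x)%E.
Proof. by apply: le_ereal_inf_tmp => _ [t [t0 _] <-]; rewrite lee_fin. Qed.

Lemma minimal_time_lt x l : (minimal_time F Omega x < l%:E)%E ->
  exists t q, [/\ 0 <= t, t < l, F q & Omega (x + t *: q)].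
Proof.
move=> /ereal_inf_lt[_ [t [t0 [_ [[q Fq <-] Oxq]]] <-]].
by rewrite lte_fin => tl; exists t, q.
Qed.

Lemma minimal_time_eq0 x : F !=set0 -> Omega x -> minimal_time F Omega x = 0%E.
Proof.
move=> [q Fq] Ox; apply/eqP; rewrite eq_le minimal_time_ge0 andbT.
by apply: (@minimal_time_le _ q) => //; rewrite scale0r addr0.
Qed.

(** * Singular subgradients at a point of the target *)

(** Normality of [(xs, 0)] to the epigraph at [(x, 0)]: the zero component keeps
    the increment of [l] out of the left-hand side. *)
Lemma frechet_singular_minimal_timeP x xs : F !=set0 -> Omega x ->
  frechet_singular_subdifferential (minimal_time F Omega) x xs <->
  forall e, 0 < e -> exists2 d, 0 < d & forall u l,
    (minimal_time F Omega u <= l%:E)%E -> Num.max `|u - x| `|l| < d ->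
    xs (u - x) <= e * Num.max `|u - x| `|l|.
Proof.
move=> F0 Ox; rewrite /frechet_singular_subdifferential /=.
rewrite minimal_time_eq0//= frechet_normal_coneP.
split=> H e /H[d d0 Hd]; exists d => //.
  move=> u l Tul ud; have := Hd (u, l) Tul.
  rewrite !prod_normE /= subr0 => /(_ ud).
  by rewrite /dual_prod_fun /= mul0r addr0.
move=> [u l] Tul; rewrite !prod_normE /= subr0 => ud.
by rewrite /dual_prod_fun /= mul0r addr0; exact: Hd.
Qed.

Lemma frechet_singular_minimal_time_normal x xs : F !=set0 -> Omega x ->
  frechet_singular_subdifferential (minimal_time F Omega) x xs ->
  frechet_normal_cone x Omega xs.
Proof.
move=> F0 Ox /frechet_singular_minimal_timeP -/(_ F0 Ox) H.
apply/frechet_normal_coneP => e /H[d d0 Hd]; exists d => // u Ou ud.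
have := Hd u 0; rewrite minimal_time_eq0// normr0 max_l//.
exact.
Qed.

Lemma frechet_singular_minimal_time_positive x xs : F !=set0 -> Omega x ->
  frechet_singular_subdifferential (minimal_time F Omega) x xs ->
  positive_dual F xs.
Proof.
move=> F0 Ox /frechet_singular_minimal_timeP -/(_ F0 Ox) H q Fq.
rewrite leNgt; apply/negP => xsq.
set m := Num.max `|q| 1.
have m0 : 0 < m by rewrite lt_max ltr01 orbT.
(* With slope [e], the point [(x - t *: q, t)] gives [- xs q <= e * m]: half of
   the threshold [- xs q / m] is contradictory. *)
have e0 : 0 < - xs q / (2 * m) by rewrite divr_gt0 ?oppr_gt0 ?mulr_gt0.
have [d d0 Hd] := H _ e0.
pose t := d / (2 * m).
have t0 : 0 < t by rewrite divr_gt0 ?mulr_gt0.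
have eqm : Num.max `|x - t *: q - x| `|t| = t * m.
  rewrite addrAC subrr add0r normrN normrZ gtr0_norm//.
  by rewrite maxr_pMr ?ltW// mulr1.
have Tt : (minimal_time F Omega (x - t *: q)%R <= t%:E)%E.
  by apply: (@minimal_time_le _ q); rewrite ?ltW// subrK.
have := Hd _ _ Tt; rewrite eqm addrAC subrr add0r linearN linearZ /=.
have -> : t * m = d / 2 by rewrite /t invfM mulrA mulfVK ?gt_eqF.
have -> : - xs q / (2 * m) * (d / 2) = t * (- xs q / 2).
  by rewrite /t mulrACA (mulrC (- _)) mulrACA.
have dd : d / 2 < d by rewrite ltr_pdivrMr// ltr_pMr// ltr1n.
rewrite /GRing.scale /= -mulrN ler_pM2l// => /(_ dd).
by rewrite leNgt gtr_pMr ?oppr_gt0// invf_lt1// ltr1n.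
Qed.

(** As [F] is bounded, a short travel time means a short travelled distance, so
    a point of small minimal time is close to points of [Omega]; as [xs] is
    nonnegative on [F], travelling along [F] can only increase [xs]. *)
Lemma frechet_normal_positive_singular_minimal_time x xs :
  F !=set0 -> bounded_set F -> Omega x ->
  frechet_normal_cone x Omega xs -> positive_dual F xs ->
  frechet_singular_subdifferential (minimal_time F Omega) x xs.
Proof.
move=> F0 Fb Ox /frechet_normal_coneP Nxs pxs.
apply/frechet_singular_minimal_timeP => // e e0.
have [M M0 FM] : exists2 M, 0 < M & forall q, F q -> `|q| < M.
  by have [M M0 FM] := ex_strict_bound_gt0 Fb; exists M.
pose c := 1 + 2 * M.
have c0 : 0 < c by rewrite /c; lra.
have [d d0 Hd] := Nxs _ (divr_gt0 e0 c0).
exists (d / c); first exact: divr_gt0.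
move=> u l Tul; set s := Num.max _ _ => sd.
have us : `|u - x| <= s by rewrite le_max lexx.
have ls : `|l| <= s by rewrite le_max lexx orbT.
have [s0|s0] := leP s 0.
  have /eqP : `|u - x| = 0 by apply/eqP; rewrite eq_le normr_ge0 (le_trans us).
  rewrite normr_eq0 => /eqP ->; rewrite linear0 mulr_ge0 ?(ltW e0)//.
  exact: le_trans (normr_ge0 _) us.
(* The infimum defining the minimal time need not be attained; a slack of size
   [s] is of the order of the error that is allowed. *)
have [t [q [t0 tls Fq Ow]]] :
    exists t q, [/\ 0 <= t, t < l + s, F q & Omega (u + t *: q)].
  by apply: minimal_time_lt; apply: le_lt_trans Tul _; rewrite lte_fin ltrDl.
have ws : `|u + t *: q - x| <= c * s.
  rewrite addrAC (le_trans (ler_normD _ _))// normrZ ger0_norm//.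
  have t2s : t <= 2 * s by have := ler_norm l; lra.
  have : t * `|q| <= 2 * s * M by rewrite ler_pM// ltW// FM.
  by rewrite /c; lra.
have wd : `|u + t *: q - x| < d.
  by apply: le_lt_trans ws _; rewrite mulrC -ltr_pdivlMr.
have xuw : xs (u - x) <= xs (u + t *: q - x).
  by rewrite [u + _ - x]addrAC (linearD _ (u - x)) lerDl linearZ mulr_ge0// pxs.
apply: le_trans xuw _; apply: le_trans (Hd _ Ow wd) _.
by rewrite -mulrA ler_pM2l// mulrC ler_pdivrMr// mulrC.
Qed.

End minimal_time.

Theorem proposition4p2 (R : realType) (X : normedModType R) (Omega F : set X)
    (hOmega0 : Omega !=set0) (hOmega : closed Omega)
    (hF0 : F !=set0) (hFclosed : closed F) (hFbounded : bounded_set F)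
    (hFconvex : convex_set F) (hF : F <> [set 0])
    (xbar : X) (hxbar : Omega xbar) :
  frechet_singular_subdifferential (minimal_time F Omega) xbar =
  frechet_normal_cone xbar Omega `&` positive_dual F.
Proof.
apply/seteqP; split=> [xs sxs|xs [nxs pxs]].
  split; first exact: frechet_singular_minimal_time_normal sxs.
  exact: frechet_singular_minimal_time_positive sxs.
exact: frechet_normal_positive_singular_minimal_time.
Qed.
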